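(* Let $\mathcal{P}$ be a simplex-like poset. Fix a total order on $\mathrm{Ob}_0(\mathcal{P})$ and, for $p\in\mathrm{Ob}_n(\mathcal{P})$, write $p=v_0v_1\cdots v_n$, where $v_0<v_1<\cdots<v_n$ are the elements of $\mathrm{Ob}_0(\mathcal{P})$ lying below $p$; for $n\ge1$ write $v_0\cdots\hat{v_j}\cdots v_n$ for the unique object $q\le p$ of degree $n-1$ such that the elements of $\mathrm{Ob}_0(\mathcal{P})$ below $q$ are the $v_i$ with $i\ne j$. Then there exists a cochain complex $$0\rightarrow\mathbb{Z}^{\mathrm{Ob}_0(\mathcal{P})}\xrightarrow{d_0}\mathbb{Z}^{\mathrm{Ob}_1(\mathcal{P})}\xrightarrow{d_1}\mathbb{Z}^{\mathrm{Ob}_2(\mathcal{P})}\xrightarrow{d_2}\cdots$$ whose cohomology is $H^*(\mathcal{P};\mathbb{Z})$, and in which, for $n\ge1$, $p=v_0v_1\cdots v_n\in\mathrm{Ob}_n(\mathcal{P})$ and $x\in\mathbb{Z}^{\mathrm{Ob}_{n-1}(\mathcal{P})}$, $$d_{n-1}(x)_p=\sum_{j=0}^n(-1)^{n-j}x_{v_0v_1\cdots\hat{v_j}\cdots v_n}.$$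
   Context: A poset is regarded as a category with exactly one arrow $p\to p'$ if $p\le p'$ and none otherwise. $\triangle_n$ denotes the poset of (non-empty) faces of the standard $n$-dimensional simplex ordered by inclusion. A poset $\mathcal{P}$ is simplex-like if for every $p\in\mathrm{Ob}(\mathcal{P})$ the full subcategory $(\mathcal{P}\downarrow p)$ on $\{q\mid q\le p\}$ is isomorphic to $\triangle_n$ for some $n\ge0$; then $\deg(p)=n$ and $\mathrm{Ob}_n(\mathcal{P})$ is the set of objects of degree $n$. $\mathbb{Z}^{X}=\prod_{x\in X}\mathbb{Z}$ is the group of all functions $X\to\mathbb{Z}$. $H^*(\mathcal{P};\mathbb{Z})$ is the integral cohomology of the geometric realization $|\mathcal{P}|$ (of the nerve) of $\mathcal{P}$; equivalently of $|\mathcal{P}^{op}|$, i.e. the right derived functors of $\varprojlim$ on the constant functor $\mathbb{Z}$. *)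

(* Defs.v *)
From HB Require Import structures.
From mathcomp Require Import all_boot all_order all_algebra.
From mathcomp Require Import boolp functions zify.

Set Implicit Arguments.
Unset Strict Implicit.
Unset Printing Implicit Defensive.

Import Order.TTheory GRing.Theory.
Local Open Scope ring_scope.

(* The poset [triangle_n] of non-empty faces of the standard n-simplex, a face
   being identified with its set of vertices; the order is inclusion. *)
Definition simplex_face (n : nat) := {A : {set 'I_n.+1} | A != set0}.

Definition mk_face n (A : {set 'I_n.+1}) (A0 : A != set0) : simplex_face n :=
  exist _ A A0.

Section SimplexLike.
Variables (disp : Order.disp_t) (P : porderType disp).

Definition down (p : P) := {q : P | (q <= p)%O}.

Definition mk_down (p q : P) (qp : (q <= p)%O) : down p := exist _ q qp.

(* [down p] is isomorphic to [triangle_n], i.e. [deg p = n]: an isomorphism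
   between posets seen as categories is an order isomorphism. *)
Definition has_deg (p : P) (n : nat) : Prop :=
  exists f : down p -> simplex_face n, bijective f /\
    forall x y, (val x <= val y)%O = (val (f x) \subset val (f y)).

Definition simplex_like : Prop := forall p : P, exists n, has_deg p n.

Definition Ob (n : nat) := {p : P | `[< has_deg p n >]}.

Definition total_order (T : Type) (le : rel T) : Prop :=
  [/\ total le, transitive le & antisymmetric le].

Section Vertices.
Variable le0 : rel (Ob 0).

(* [p = v_0 v_1 ... v_n] *)
Definition vertices_of n (p : P) (v : 'I_n.+1 -> Ob 0) : Prop :=
  (forall i j, le0 (v i) (v j) = (i <= j)%N) /\
  (forall w : Ob 0, (val w <= p)%O <-> exists i, w = v i).

(* [q = v_0 ... ^v_j ... v_n], as a degree [n - 1] object below [p] *)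
Definition face_of n (p : P) (v : 'I_n.+2 -> Ob 0) (j : 'I_n.+2) (q : Ob n) :
  Prop :=
  (val q <= p)%O /\
  (forall w : Ob 0, (val w <= val q)%O <-> exists2 i, i != j & w = v i).

End Vertices.

(* In any poset the objects of degree 0 are exactly the minimal ones. *)
Lemma has_deg0P (w : P) : has_deg w 0 <-> forall q : P, (q <= w)%O -> q = w.
Proof.
split=> [[f [fbij fle]] q qw|minw].
  have f1 (A B : simplex_face 0) : A = B.
    apply: val_inj; case: A B => [A /= A0] [B /= B0].
    have full (C : {set 'I_1}) : C != set0 -> C = setT.
      case/set0Pn=> i iC; apply/setP=> k; rewrite inE.
      by rewrite (ord1 k) -(ord1 i).
    by rewrite (full A A0) (full B B0).
  have [g fK _] := fbij.
  have := congr1 g (f1 (f (mk_down qw)) (f (mk_down (lexx w)))).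
  by rewrite !fK => /(congr1 val).
have T0 : [set: 'I_1] != set0 by apply/set0Pn; exists ord0; rewrite inE.
pose top : simplex_face 0 := mk_face T0.
have d1 (x : down w) : x = mk_down (lexx w).
  by apply: val_inj; apply: minw; exact: valP x.
have f1 (A : simplex_face 0) : A = top.
  apply: val_inj => /=; case: A => [A /=] /set0Pn [i iA].
  by apply/setP=> k; rewrite inE (ord1 k) -(ord1 i).
exists (fun _ => top); split.
  by exists (fun _ => mk_down (lexx w)) => [x|A]; rewrite -?d1 -?f1.
by move=> x y; rewrite (d1 x) (d1 y) lexx subxx.
Qed.

(* [u i] is the object at the vertex [i] of the simplex below [p], and [g A] the
   object at its face [A]. *)
Lemma simplex_chart n (p : P) : has_deg p n ->
  exists (u : 'I_n.+1 -> Ob 0) (g : {set 'I_n.+1} -> P),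
  [/\ injective u,
      forall w : Ob 0, (val w <= p)%O <-> exists i, w = u i,
      forall q : P, (q <= p)%O -> exists2 A, A != set0 & q = g A,
      forall A, A != set0 -> (g A <= p)%O &
      (forall A B, A != set0 -> B != set0 ->
        (g A <= g B)%O = (A \subset B)) /\
      (forall i A, A != set0 -> (val (u i) <= g A)%O = (i \in A))].
Proof.
case=> f [[h fK hK] fle].
pose g (A : {set 'I_n.+1}) : P :=
  if insub A is Some s then val (h s) else p.
have gE A (A0 : A != set0) : g A = val (h (mk_face A0)).
  by rewrite /g insubT.
have gp A : A != set0 -> (g A <= p)%O.
  by move=> A0; rewrite (gE _ A0); exact: valP (h _).
have gle A B : A != set0 -> B != set0 ->
    (g A <= g B)%O = (A \subset B).
  by move=> A0 B0; rewrite (gE _ A0) (gE _ B0) fle !hK.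
have gS q : (q <= p)%O -> exists2 A, A != set0 & q = g A.
  move=> qp; exists (val (f (mk_down qp))); first exact: valP (f _).
  rewrite (gE _ (valP (f (mk_down qp)))) /=.
  rewrite [X in h X](_ : _ = f (mk_down qp)); last exact: val_inj.
  by rewrite fK.
have s0 (i : 'I_n.+1) : [set i] != set0 by apply/set0Pn; exists i; rewrite inE.
have gmin i : `[< has_deg (g [set i]) 0 >].
  apply/asboolP/has_deg0P => q qi.
  have [A A0 qA] := gS _ (le_trans qi (gp _ (s0 i))).
  move: qi; rewrite qA gle // subset1 (negPf A0) orbF.
  by move/eqP->.
exists (fun i => exist _ (g [set i]) (gmin i)), g; split=> //.
- move=> i j /(congr1 val) /= e.
  have : (g [set i] <= g [set j])%O by rewrite e.
  by rewrite gle // sub1set inE => /eqP.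
- move=> w; split=> [wp|[i ->]]; last exact: gp.
  have [A A0 wA] := gS _ wp; have /set0Pn [i iA] := A0.
  exists i; apply: val_inj => /=.
  have /asboolP/has_deg0P wmin := valP w.
  by apply/esym/wmin; rewrite wA gle // sub1set.
- by split=> // i A A0; rewrite gle // sub1set.
Qed.

Variables (le0 : rel (Ob 0)) (le0T : total_order le0).

Lemma vertices_ex n (p : Ob n) :
  exists v : 'I_n.+1 -> Ob 0, vertices_of le0 (val p) v.
Proof.
have [tot tr anti] := le0T.
have /asboolP/simplex_chart [u [g [uI uP _ _ _]]] := valP p.
pose s := sort le0 (codom u).
have szs : size s = n.+1 by rewrite size_sort size_codom card_ord.
have sU : uniq s by rewrite sort_uniq map_inj_uniq ?enum_uniq.
have sS : sorted le0 s by apply: sort_sorted.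
have refl : reflexive le0 by move=> x; have := tot x x; rewrite orbb.
have w0 := u ord0.
exists (fun i => nth w0 s i); split=> [i j|w].
  have [ij|ji] := leqP i j.
    by apply: (sorted_leq_nth tr refl) => //; rewrite inE szs.
  apply/negbTE/negP => le_ij.
  have le_ji : le0 (nth w0 s j) (nth w0 s i).
    by apply: (sorted_leq_nth tr refl) => //; rewrite ?inE ?szs ?ltn_ord // ltnW.
  have /eqP := anti _ _ (introT andP (conj le_ij le_ji)).
  by rewrite nth_uniq ?szs // => /eqP e; rewrite e ltnn in ji.
rewrite uP; split=> [[i ->]|[i ->]].
  have us : u i \in s by rewrite mem_sort codom_f.
  have lt : (index (u i) s < n.+1)%N by rewrite -szs index_mem.
  by exists (Ordinal lt); rewrite /= nth_index.
have : nth w0 s i \in s by rewrite mem_nth // szs.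
by rewrite mem_sort => /codomP [k ->]; exists k.
Qed.

Definition vertices n (p : Ob n) : 'I_n.+1 -> Ob 0 := sval (cid (vertices_ex p)).

Lemma verticesP n (p : Ob n) : vertices_of le0 (val p) (vertices p).
Proof. exact: svalP (cid (vertices_ex p)). Qed.

Lemma face_exuniq n (p : Ob n.+1) (j : 'I_n.+2) :
  exists! q : Ob n, face_of (val p) (vertices p) j q.
Proof.
have [tot tr anti] := le0T.
have refl : reflexive le0 by move=> x; have := tot x x; rewrite orbb.
have /asboolP/simplex_chart [u [g [uI uP gS gp [gle ug]]]] := valP p.
have [vmono vP] := verticesP p; set v := vertices p in vmono vP *.
have vI : injective v.
  move=> a b e; apply/val_inj/eqP.
  by rewrite eqn_leq -!vmono e refl.
have /uP [k vk] : (val (v j) <= val p)%O by apply/vP; exists j.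
pose A := [set~ k].
have A0 : A != set0.
  by apply/set0Pn; exists (lift k ord0); rewrite !inE eq_sym neq_lift.
have ug' w : (val w <= g A)%O <-> exists2 i, i != j & w = v i.
  split=> [wg|[i ij ->]].
    have wp := le_trans wg (gp _ A0).
    have /vP [i wi] := wp; have /uP [l wl] := wp.
    exists i => //; apply/eqP => e; move: wg.
    by rewrite wl ug // !inE => /eqP; apply; apply: uI; rewrite -wl wi e vk.
  have /uP [l il] : (val (v i) <= val p)%O by apply/vP; exists i.
  rewrite il ug // !inE; apply/eqP => e; case/eqP: ij; apply: vI.
  by rewrite il e vk.
have subA (x : down (g A)) : exists B : simplex_face n,
    val x = g [set lift k i | i in val B].
  have [C C0 xC] := gS _ (le_trans (valP x) (gp _ A0)).
  have CA : C \subset A by rewrite -gle // -xC; exact: valP x.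
  have CE : [set lift k i | i in [set i | lift k i \in C]] = C.
    apply/setP=> a; apply/imsetP/idP => [[i]|aC]; first by rewrite inE => iC ->.
    have := fintype.subsetP CA _ aC; rewrite !inE => ak.
    case: (unliftP k a) => [i ai|e]; last by rewrite e eqxx in ak.
    by exists i => //; rewrite inE -ai.
  have B0 : [set i | lift k i \in C] != set0.
    by apply: contraNneq C0 => e; rewrite -CE e imset0.
  by exists (mk_face B0); rewrite /= CE.
have im0 (B : simplex_face n) : [set lift k i | i in val B] != set0.
  have /set0Pn [i iB] := valP B.
  by apply/set0Pn; exists (lift k i); apply: imset_f.
have imA (B : simplex_face n) : (g [set lift k i | i in val B] <= g A)%O.
  rewrite gle //; apply/fintype.subsetP => a /imsetP [i _ ->].
  by rewrite !inE eq_sym neq_lift.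
have imS (B C : simplex_face n) :
    ([set lift k i | i in val B] \subset [set lift k i | i in val C])
    = (val B \subset val C).
  apply/idP/idP => [/fintype.subsetP h|]; last exact: imsetS.
  apply/fintype.subsetP => i iB.
  by have /imsetP [l lC /lift_inj ->] := h _ (imset_f (lift k) iB).
pose f x : simplex_face n := sval (cid (subA x)).
have fE x : val x = g [set lift k i | i in val (f x)] by exact: svalP (cid (subA x)).
have fle x y : (val x <= val y)%O = (val (f x) \subset val (f y)).
  by rewrite !fE gle // imS.
have gdeg : `[< has_deg (g A) n >].
  apply/asboolP; exists f; split=> //.
  exists (fun B => mk_down (imA B) : down (g A)) => [x|B].
    by apply: val_inj; rewrite /= -fE.
  set x := mk_down _.
  have e : g [set lift k i | i in val B] = g [set lift k i | i in val (f x)].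
    by rewrite -fE.
  apply: val_inj; apply/eqP; rewrite eqEsubset -!imS -!gle //.
  by rewrite -!e lexx.
exists (exist _ (g A) gdeg); split=> [|q' [q'p q'v]].
  by split; [exact: gp|exact: ug'].
apply: val_inj => /=.
have [C C0 qC] := gS _ q'p; rewrite qC; congr g.
apply/setP=> i; rewrite -[LHS]ug // -[RHS]ug // -qC.
by apply/idP/idP => [/ug' /q'v|/q'v /ug'].
Qed.

Definition face n (p : Ob n.+1) (j : 'I_n.+2) : Ob n :=
  sval (cid (face_exuniq p j)).

Lemma faceP n (p : Ob n.+1) (j : 'I_n.+2) :
  face_of (val p) (vertices p) j (face p j).
Proof. by case: (svalP (cid (face_exuniq p j))). Qed.

End SimplexLike.

Arguments Ob {disp} P n.
Arguments simplex_like {disp} P.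

Definition zmod_iso (U V : zmodType) : Prop :=
  exists f : {additive U -> V}, bijective f.

Record cochain_complex := CochainComplex {
  term :> nat -> zmodType;
  diff : forall n, {additive term n -> term n.+1};
  diffK : forall n x, diff n.+1 (diff n x) = 0
}.
Arguments diff : clear implicits.

Section Cohomology.
Variables (K : cochain_complex) (n : nat).

Definition is_cocycle : {pred K n} := fun x => diff K n x == 0.

Lemma is_cocycle_zmod : zmod_closed is_cocycle.
Proof.
split=> [|x y]; rewrite !unfold_in ?raddf0 //.
by move=> /eqP x0 /eqP y0; rewrite raddfB x0 y0 subr0.
Qed.
HB.instance Definition _ := GRing.isZmodClosed.Build _ is_cocycle is_cocycle_zmod.

Record cocycle := Cocycle { cocycle_val :> K n; _ : cocycle_val \in is_cocycle }.
HB.instance Definition _ := [isSub for cocycle_val].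
HB.instance Definition _ := [Choice of cocycle by <:].
HB.instance Definition _ := [SubChoice_isSubZmodule of cocycle by <:].

End Cohomology.

(* There is no cochain in degree -1. *)
Definition is_coboundary (K : cochain_complex) (n : nat) : {pred cocycle K n} :=
  match n with
  | 0 => fun x => x == 0
  | m.+1 => fun x => `[< exists y : K m, diff K m y = val x >]
  end.

Lemma is_coboundary_zmod K n : zmod_closed (@is_coboundary K n).
Proof.
case: n => [|n]; split=> [|x y]; rewrite !unfold_in //=.
- by move=> /eqP-> /eqP->; rewrite subr0.
- by apply/asboolP; exists 0; rewrite raddf0.
- move=> /asboolP [a ax] /asboolP [b yb]; apply/asboolP; exists (a - b).
  by rewrite !raddfB ax yb.
Qed.
HB.instance Definition _ K n :=
  GRing.isZmodClosed.Build _ (@is_coboundary K n) (@is_coboundary_zmod K n).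

Definition cohomology (K : cochain_complex) (n : nat) : zmodType :=
  ring_quotient.Quotient.quot (@is_coboundary K n).

Section Nerve.
Variables (disp : Order.disp_t) (P : porderType disp).

(* n-simplices of the nerve: functors from [0 < 1 < ... < n] to [P] *)
Definition nerve (n : nat) :=
  {c : {ffun 'I_n.+1 -> P} |
    [forall i : 'I_n.+1, forall j : 'I_n.+1, (i <= j)%N ==> (c i <= c j)%O]}.

Lemma nerve_face_subproof n (c : nerve n.+1) (k : 'I_n.+2) :
  [forall i : 'I_n.+1, forall j : 'I_n.+1, (i <= j)%N ==>
    ([ffun i => val c (lift k i)] i <= [ffun i => val c (lift k i)] j)%O].
Proof.
apply/forallP=> i; apply/forallP=> j; apply/implyP=> ij; rewrite !ffunE.
by have /forallP/(_ (lift k i))/forallP/(_ (lift k j))/implyP := valP c; apply; rewrite leq_bump2.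
Qed.

Definition nerve_face n (k : 'I_n.+2) (c : nerve n.+1) : nerve n :=
  Sub [ffun i => val c (lift k i)] (nerve_face_subproof c k).

Definition nerve_diff n (x : nerve n -> int) (c : nerve n.+1) : int :=
  \sum_(k < n.+2) (-1) ^+ k * x (nerve_face k c).

Lemma nerve_diff_additive n : zmod_morphism (@nerve_diff n).
Proof.
move=> x y; apply/funext => c.
rewrite /nerve_diff [RHS]/GRing.add /= [X in _ + X]/GRing.opp /= -sumrB.
by apply: eq_bigr => k _; rewrite -mulrBr.
Qed.
HB.instance Definition _ n :=
  GRing.isZmodMorphism.Build _ _ (@nerve_diff n) (@nerve_diff_additive n).

Lemma nerve_faceC n (c : nerve n.+2) (k l : 'I_n.+2) : (k <= l)%N ->
  nerve_face l (nerve_face (inord k) c) = nerve_face k (nerve_face (lift ord0 l) c).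
Proof.
move=> kl; apply/val_inj/ffunP => i; rewrite /= !ffunE; congr ((val c : {ffun _ -> _}) _).
apply: val_inj; rewrite /= inordK /bump /=; last by rewrite ltnS ltnW.
lia.
Qed.

Lemma nerve_diffK n (x : nerve n -> int) : nerve_diff (nerve_diff x) = 0.
Proof.
apply/funext => c; rewrite /nerve_diff /=.
under eq_bigr do rewrite mulr_sumr.
rewrite pair_big /= (bigID (fun kl : 'I_n.+3 * 'I_n.+2 => (kl.1 <= kl.2)%N)) /=.
pose h (kl : 'I_n.+3 * 'I_n.+2) : 'I_n.+3 * 'I_n.+2 :=
  (lift ord0 kl.2, inord kl.1).
pose h' (kl : 'I_n.+3 * 'I_n.+2) : 'I_n.+3 * 'I_n.+2 :=
  (inord kl.2, inord kl.1.-1).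
rewrite [X in _ + X](reindex_onto h h') /=; last first.
  move=> [k l] /=; rewrite -ltnNge => lk; rewrite /h /h' /=; congr pair.
    by apply: val_inj; rewrite /= inordK /bump /=; have := ltn_ord k; lia.
  by apply: val_inj; rewrite /= !inordK //; have := ltn_ord l; lia.
rewrite [X in _ + X](eq_bigl (fun kl : 'I_n.+3 * 'I_n.+2 => (kl.1 <= kl.2)%N)).
  rewrite -big_split big1 //= => -[k l] /= kl.
  have lt : (k < n.+2)%N by apply: leq_ltn_trans kl _.
  pose k' : 'I_n.+2 := Ordinal lt.
  have ke : k = inord k' by apply: val_inj; rewrite /= inordK // ltnW.
  have ke' : inord k = k' :> 'I_n.+2 by apply: val_inj; rewrite /= inordK.
  rewrite ke' {2}ke nerve_faceC // !mulrA -!exprD /bump /= add1n addSn.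
  rewrite exprS mulN1r mulNr [X in (-1) ^+ X]addnC.
  by rewrite subrr.
move=> [k l] /=; rewrite /h /h' /bump /= add1n.
apply/idP/idP => [/andP [H /eqP [ek _]]|kl].
  rewrite -ltnNge ltnS in H; rewrite -ek inordK //.
  by rewrite ltnW // ltnS ltn_ord.
have lt : (k < n.+2)%N by apply: leq_ltn_trans kl _.
have ek : (inord k : 'I_n.+2) = k :> nat by rewrite inordK.
rewrite -ltnNge ltnS ek kl; apply/eqP; congr pair; apply: val_inj => /=.
  by rewrite inordK // ltnW.
by rewrite add0n inordK.
Qed.

(* The (unnormalised) integral cochains of the nerve; its cohomology is the
   integral cohomology of the geometric realization of [P]. *)
Definition nerve_cochains : cochain_complex :=
  @CochainComplex (fun n => nerve n -> int) (fun n => @nerve_diff n) nerve_diffK.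

End Nerve.

Section ProductOfGroups.
Variables (I : Type) (F : I -> zmodType).

Definition dprod := forall i, F i.
HB.instance Definition _ := gen_eqMixin dprod.
HB.instance Definition _ := gen_choiceMixin dprod.

Definition dprod_zero : dprod := fun=> 0.
Definition dprod_opp (x : dprod) : dprod := fun i => - x i.
Definition dprod_add (x y : dprod) : dprod := fun i => x i + y i.

Lemma dprod_addA : associative dprod_add.
Proof. by move=> x y z; apply: functional_extensionality_dep => i; apply: addrA. Qed.
Lemma dprod_addC : commutative dprod_add.
Proof. by move=> x y; apply: functional_extensionality_dep => i; apply: addrC. Qed.
Lemma dprod_add0 : left_id dprod_zero dprod_add.
Proof. by move=> x; apply: functional_extensionality_dep => i; apply: add0r. Qed.
Lemma dprod_addN : left_inverse dprod_zero dprod_opp dprod_add.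
Proof. by move=> x; apply: functional_extensionality_dep => i; apply: addNr. Qed.
HB.instance Definition _ := GRing.isZmodule.Build dprod
  dprod_addA dprod_addC dprod_add0 dprod_addN.

End ProductOfGroups.

Section HigherLimits.
Variables (disp : Order.disp_t) (P : porderType disp).

Record diagram := Diagram {
  obj :> P -> zmodType;
  arr : forall p q : P, (p <= q)%O -> {additive obj p -> obj q};
  arr_id : forall (p : P) (pp : (p <= p)%O) x, arr pp x = x;
  arr_comp : forall (p q r : P) (pq : (p <= q)%O) (qr : (q <= r)%O)
    (pr : (p <= r)%O) x, arr qr (arr pq x) = arr pr x
}.

Record nat_trans (F G : diagram) := NatTrans {
  app :> forall p, {additive F p -> G p};
  naturality : forall (p q : P) (pq : (p <= q)%O) x,
    app q (arr F pq x) = arr G pq (app p x)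
}.

Definition constZ : diagram :=
  @Diagram (fun=> int) (fun _ _ _ => idfun) (fun _ _ _ => erefl)
    (fun _ _ _ _ _ _ _ => erefl).

(* Monomorphisms of diagrams are the pointwise injective transformations. *)
Definition injective_diagram (J : diagram) : Prop :=
  forall (F G : diagram) (m : nat_trans F G) (f : nat_trans F J),
    (forall p, injective (m p)) ->
    exists g : nat_trans G J, forall p x, g p (m p x) = f p x.

Record injective_resolution (A : diagram) := InjectiveResolution {
  res : nat -> diagram;
  res_diff : forall n, nat_trans (res n) (res n.+1);
  res_aug : nat_trans A (res 0);
  res_injective : forall n, injective_diagram (res n);
  res_aug_inj : forall p, injective (res_aug p);
  res_exact0 : forall p x, res_diff 0 p x = 0 <-> exists a, res_aug p a = x;
  res_exact : forall n p x,
    res_diff n.+1 p x = 0 <-> exists y, res_diff n p y = x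
}.

Definition compatible (F : diagram) : {pred dprod F} :=
  fun x => `[< forall (p q : P) (pq : (p <= q)%O), arr F pq (x p) = x q >].

Lemma compatible_zmod F : zmod_closed (@compatible F).
Proof.
split=> [|x y]; rewrite !unfold_in; first by apply/asboolP=> p q pq; apply: raddf0.
move=> /asboolP xc /asboolP yc; apply/asboolP => p q pq.
by rewrite -[(x - y) p]/(x p - y p) raddfB xc yc.
Qed.
HB.instance Definition _ F :=
  GRing.isZmodClosed.Build _ (@compatible F) (@compatible_zmod F).

Record lim (F : diagram) := Lim { lim_val :> dprod F; _ : lim_val \in @compatible F }.
HB.instance Definition _ F := [isSub for @lim_val F].
HB.instance Definition _ F := [Choice of lim F by <:].
HB.instance Definition _ F := [SubChoice_isSubZmodule of lim F by <:].

Lemma lim_map_subproof F G (t : nat_trans F G) (x : lim F) :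
  (fun p => t p (val x p)) \in @compatible G.
Proof.
apply/asboolP=> p q pq; rewrite -naturality.
by have /asboolP-> := valP x.
Qed.

Definition lim_map F G (t : nat_trans F G) (x : lim F) : lim G :=
  Lim (lim_map_subproof t x).

Lemma lim_map_additive F G (t : nat_trans F G) : zmod_morphism (lim_map t).
Proof.
move=> x y; apply: val_inj; apply: functional_extensionality_dep => p /=.
exact: raddfB.
Qed.
HB.instance Definition _ F G t :=
  GRing.isZmodMorphism.Build _ _ (@lim_map F G t) (@lim_map_additive F G t).

Lemma lim_mapK A (R : injective_resolution A) n (x : lim (res R n)) :
  lim_map (res_diff R n.+1) (lim_map (res_diff R n) x) = 0.
Proof.
apply: val_inj; apply: functional_extensionality_dep => p /=.
by apply/res_exact; exists (val x p).
Qed.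

(* Its cohomology in degree [n] is the value at [A] of the [n]-th right derived
   functor of [lim]. *)
Definition lim_complex A (R : injective_resolution A) : cochain_complex :=
  @CochainComplex (fun n => lim (res R n)) (fun n => lim_map (res_diff R n))
    (@lim_mapK A R).

End HigherLimits.

(* Main.v *)
(* For a covariant diagram [F] on [P] let [C^n F] be the product of the groups
   [F q], [q] of degree [n], with the alternating sum of the restrictions along
   faces as differential.  If [F] is coinduced, i.e. [F p] is the product of
   groups [A i] over the [i] with [p <= t i], then [C F] is the product over [i]
   of the simplicial cochains of the simplex below [t i] with coefficients in
   [A i]; that simplex is contractible (a cone over its last vertex), so [C F]
   is exact in positive degrees, with [lim F] as [H^0].  The same holds for an
   injective diagram, which is a retract of a coinduced one.  Hence for every
   resolution [Z -> R^0 -> R^1 -> ...] by such diagrams the double complex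
   [C^i (R^j)] has exact rows and columns, and identifies the cohomology of
   [C Z], the complex of the theorem, with that of [lim R].  This applies both to
   an injective resolution and to the resolution sending [p] to the cochains of
   the nerve of [{q | p <= q}], whose limit is the complex of nerve cochains. *)
From HB Require Import structures.
Require Import Defs.
From mathcomp Require Import all_boot all_order all_algebra.
From mathcomp Require Import boolp functions zify.

Set Implicit Arguments.
Unset Strict Implicit.
Unset Printing Implicit Defensive.

Import Order.TTheory GRing.Theory.
Local Open Scope ring_scope.

(** * Double complexes *)

(* An isomorphism [Z1 / B1 = Z2 / B2] given by an additive relation, so that
   zigzags in a double complex compose without choosing representatives. *)
Definition subquot_iso (U V : zmodType) (Z1 B1 : U -> Prop)
    (Z2 B2 : V -> Prop) :=
  exists rel : U -> V -> Prop,
  [/\ forall u v u' v', rel u v -> rel u' v' -> rel (u - u') (v - v'),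
      forall u v, rel u v -> Z1 u /\ Z2 v,
      forall u, Z1 u -> exists v, rel u v,
      forall v, Z2 v -> exists u, rel u v &
      forall u v, rel u v -> (B1 u <-> B2 v)].

Lemma subquot_iso_sym (U V : zmodType) (Z1 B1 : U -> Prop) (Z2 B2 : V -> Prop) :
  subquot_iso Z1 B1 Z2 B2 -> subquot_iso Z2 B2 Z1 B1.
Proof.
case=> r [rB rZ r1 r2 rS]; exists (fun v u => r u v); split=> //.
- by move=> v u v' u'; apply: rB.
- by move=> v u /rZ [].
- by move=> v u /rS [].
Qed.

Lemma subquot_iso_trans (U V W : zmodType) (Z1 B1 : U -> Prop)
    (Z2 B2 : V -> Prop) (Z3 B3 : W -> Prop) :
  subquot_iso Z1 B1 Z2 B2 -> subquot_iso Z2 B2 Z3 B3 ->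
  subquot_iso Z1 B1 Z3 B3.
Proof.
case=> r [rB rZ r1 r2 rS] [s [sB sZ s1 s2 sS]].
exists (fun u w => exists2 v, r u v & s v w); split.
- move=> u w u' w' [v ruv svw] [v' ruv' svw'].
  by exists (v - v'); [apply: rB | apply: sB].
- by move=> u w [v /rZ [? _] /sZ [_ ?]].
- move=> u /r1 [v ruv]; have [_ /s1 [w svw]] := rZ _ _ ruv.
  by exists w, v.
- move=> w /s2 [v svw]; have [/r2 [u ruv] _] := sZ _ _ svw.
  by exists u, v.
- by move=> u w [v /rS ruv /sS svw]; apply: iff_trans ruv svw.
Qed.

Lemma subquot_iso_ext (U V : zmodType) (Z1 B1 B1' : U -> Prop)
    (Z2 B2 : V -> Prop) :
  (forall u, Z1 u -> (B1 u <-> B1' u)) ->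
  subquot_iso Z1 B1 Z2 B2 -> subquot_iso Z1 B1' Z2 B2.
Proof.
move=> BB [r [rB rZ r1 r2 rS]]; exists r; split=> // u v ruv.
have [Zu _] := rZ _ _ ruv.
by apply: iff_trans (rS _ _ ruv); apply: iff_sym; apply: BB.
Qed.

(** The relation is the graph of [f] restricted to [Z1]; the last hypothesis makes it well defined
    and injective on the quotients. *)
Lemma subquot_iso_inj (U V : zmodType) (f : {additive U -> V})
    (Z1 B1 : U -> Prop) (Z2 B2 : V -> Prop) :
  (forall u u', Z1 u -> Z1 u' -> Z1 (u - u')) ->
  (forall u, Z1 u -> Z2 (f u)) ->
  (forall v, Z2 v -> exists2 u, Z1 u & f u = v) ->
  (forall u, Z1 u -> (B1 u <-> B2 (f u))) ->
  subquot_iso Z1 B1 Z2 B2.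
Proof.
move=> ZB Zf fZ Bf; exists (fun u v => Z1 u /\ f u = v); split.
- by move=> u v u' v' [Zu <-] [Zu' <-]; split; [apply: ZB | rewrite raddfB].
- by move=> u v [Zu <-]; split=> //; apply: Zf.
- by move=> u Zu; exists (f u).
- by move=> v /fZ [u Zu fu]; exists u.
- by move=> u v [Zu <-]; apply: Bf.
Qed.

Section CohomologySubquotient.
Variable K : cochain_complex.

Definition coboundary n : K n -> Prop :=
  match n with
  | 0 => fun x => x = 0
  | m.+1 => fun x => exists y : K m, diff K m y = x
  end.

Lemma is_coboundaryP n (x : cocycle K n) :
  reflect (coboundary (val x)) (x \in @is_coboundary K n).
Proof.
case: n x => [|n] x; rewrite unfold_in /=; last exact: asboolP.
apply: (iffP eqP) => [->|x0] //; exact: val_inj.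
Qed.

Lemma cocycleP n (x : cocycle K n) : diff K n (val x) = 0.
Proof. by apply/eqP; exact: (valP x). Qed.

Lemma cocycle_ex n (x : K n) :
  diff K n x = 0 -> exists z : cocycle K n, val z = x.
Proof.
move=> /eqP x0; have xZ : x \in @is_cocycle K n by [].
by exists (Cocycle xZ).
Qed.

End CohomologySubquotient.

(** Related cocycles are chosen in both directions. The resulting maps on classes are independent of
    the choices and mutually inverse, because the relation respects and reflects coboundaries. *)
Lemma zmod_iso_cohomology (K L : cochain_complex) n m :
  subquot_iso (fun x : K n => diff K n x = 0) (@coboundary K n)
              (fun x : L m => diff L m x = 0) (@coboundary L m) ->
  zmod_iso (cohomology K n) (cohomology L m).
Proof.
case=> r [rB rZ r1 r2 rS].
have [f fr] : {f : cocycle K n -> cocycle L m &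
    forall x, r (val x) (val (f x))}.
  apply: (@choice _ _ (fun x y => r (val x) (val y))) => x.
  have [v rxv] := r1 _ (cocycleP x); have [_ /cocycle_ex [z zv]] := rZ _ _ rxv.
  by exists z; rewrite zv.
pose piK (x : cocycle K n) := (\pi_(cohomology K n) x)%qT.
pose piL (x : cocycle L m) := (\pi_(cohomology L m) x)%qT.
have eqK x y : piK x = piK y <-> coboundary (val x - val y).
  have -> : val x - val y = val (x - y) by rewrite raddfB.
  split=> [/eqP|/is_coboundaryP]; last by rewrite Quotient.idealrBE => /eqP.
  by rewrite -Quotient.idealrBE => /is_coboundaryP.
have eqL x y : piL x = piL y <-> coboundary (val x - val y).
  have -> : val x - val y = val (x - y) by rewrite raddfB.
  split=> [/eqP|/is_coboundaryP]; last by rewrite Quotient.idealrBE => /eqP.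
  by rewrite -Quotient.idealrBE => /is_coboundaryP.
(* Applied to differences, the clause on coboundaries says that related cocycles have equal classes
   on one side exactly when they do on the other. *)
have eqr x y x' y' : r (val x) (val y) -> r (val x') (val y') ->
    (piK x = piK x' <-> piL y = piL y').
  move=> rx rx'; rewrite eqK eqL; apply: rS; exact: rB.
pose F (a : cohomology K n) : cohomology L m := piL (f (repr a)).
have FE x y : r (val x) (val y) -> F (piK x) = piL y.
  move=> rxy; apply/(eqr _ _ _ _ (fr (repr (piK x))) rxy).
  by rewrite /piK reprK.
have FB : zmod_morphism F.
  move=> a b; rewrite -[a]reprK -[b]reprK.
  rewrite (FE _ _ (fr (repr a))) (FE _ _ (fr (repr b))).
  rewrite -[X in F X](raddfB (\pi_(cohomology K n))%qT).
  rewrite -[RHS](raddfB (\pi_(cohomology L m))%qT).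
  by apply: FE; rewrite !raddfB; apply: rB; apply: fr.
pose FA := GRing.isZmodMorphism.Build _ _ F FB.
pose FF : {additive cohomology K n -> cohomology L m} := HB.pack F FA.
exists FF.
have [g gr] : {g : cocycle L m -> cocycle K n &
    forall x, r (val (g x)) (val x)}.
  apply: (@choice _ _ (fun y x => r (val x) (val y))) => y.
  have [u ruy] := r2 _ (cocycleP y); have [/cocycle_ex [z zu] _] := rZ _ _ ruy.
  by exists z; rewrite zu.
exists (fun b => piK (g (repr b))) => [a|b] /=.
  rewrite -[RHS]reprK; apply/(eqr _ _ _ _ (gr _) (fr _)).
  by rewrite /piL reprK.
by rewrite (FE _ _ (gr _)) /piL reprK.
Qed.

Section DoubleComplex.
Variables (A B : cochain_complex) (K : nat -> nat -> zmodType).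
Variables (d1 : forall i j, {additive K i j -> K i.+1 j})
  (d2 : forall i j, {additive K i j -> K i j.+1})
  (e : forall i, {additive A i -> K i 0})
  (h : forall j, {additive B j -> K 0 j}).
Hypotheses (d12 : forall i j x, d1 i j.+1 (d2 i j x) = d2 i.+1 j (d1 i j x))
  (d1_exact : forall i j x, d1 i.+1 j x = 0 <-> exists y, d1 i j y = x)
  (d2_exact : forall i j x, d2 i j.+1 x = 0 <-> exists y, d2 i j y = x)
  (e_inj : forall i, injective (e i)) (h_inj : forall j, injective (h j))
  (e_exact : forall i x, d2 i 0 x = 0 <-> exists a, e i a = x)
  (h_exact : forall j x, d1 0 j x = 0 <-> exists b, h j b = x)
  (ed : forall i a, d1 i 0 (e i a) = e i.+1 (diff A i a))
  (hd : forall j b, d2 0 j (h j b) = h j.+1 (diff B j b)).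

(** Bicocycles modulo [cobd1] or [cobd2] are the intermediate groups along an antidiagonal, between
    the cohomology of [A] and that of [B]. *)
Let bicocycle i j (x : K i j) := d1 i j x = 0 /\ d2 i j x = 0.

(* For [i, j >= 1] these are the same subgroup of bicocycles ([cobd12]). *)
Let cobd1 i j (x : K i.+1 j) := exists2 y, d2 i j y = 0 & d1 i j y = x.
Let cobd2 i j (x : K i j.+1) := exists2 y, d1 i j y = 0 & d2 i j y = x.

Let d1d1 i j x : d1 i.+1 j (d1 i j x) = 0.
Proof. by apply/d1_exact; exists x. Qed.

Let d2d2 i j x : d2 i j.+1 (d2 i j x) = 0.
Proof. by apply/d2_exact; exists x. Qed.

Let cobd12 i j (x : K i.+1 j.+1) : cobd1 x <-> cobd2 x.
Proof.
split=> [[y /d2_exact [z <-] <-]|[y /d1_exact [z <-] <-]].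
  by exists (d1 i j z); rewrite ?d1d1 ?d12.
by exists (d2 i j z); rewrite ?d2d2 ?d12.
Qed.

Let bicocycleB i j (x y : K i j) : bicocycle x -> bicocycle y -> bicocycle (x - y).
Proof. by move=> [x1 x2] [y1 y2]; split; rewrite raddfB ?x1 ?x2 ?y1 ?y2 subr0. Qed.

(** A common [k] with [d2 k = x] and [d1 k = y] relates [x] to [y]; exactness for [d2] finds it from
    [x], exactness for [d1] from [y]. *)
Let zigzag i j : subquot_iso (@bicocycle i j.+1) (@cobd2 i j)
                             (@bicocycle i.+1 j) (@cobd1 i j).
Proof.
exists (fun x y => [/\ bicocycle x, bicocycle y &
  exists2 k, d2 i j k = x & d1 i j k = y]); split.
- move=> x y x' y' [Zx Zy [k kx ky]] [Zx' Zy' [k' kx' ky']].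
  split; try exact: bicocycleB.
  by exists (k - k'); rewrite raddfB ?kx ?kx' ?ky ?ky'.
- by move=> x y [].
- move=> x Zx; have [x1 /d2_exact [k kx]] := Zx.
  exists (d1 i j k); split=> //; last by exists k.
  by split; rewrite ?d1d1 // -d12 kx.
- move=> y Zy; have [/d1_exact [k ky] y2] := Zy.
  exists (d2 i j k); split=> //; last by exists k.
  by split; rewrite ?d2d2 // d12 ky.
(* If [x = d2 l] with [d1 l = 0], then [k - l] exhibits [y] as an element of [cobd1]; the converse
   is symmetric. *)
- move=> x y [Zx Zy [k kx ky]]; split=> [[l l1 l2]|[l l2 l1]].
    by exists (k - l); rewrite raddfB ?kx ?ky ?l1 ?l2 ?subrr ?subr0.
  by exists (k - l); rewrite raddfB ?kx ?ky ?l1 ?l2 ?subrr ?subr0.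
Qed.

(** [e] identifies [A i] with the kernel of [d2] in [K i 0], so cocycles of [A] become bicocycles
    and coboundaries become [cobd1]. *)
Let iso_A_bicocycle i :
  subquot_iso (fun a : A i.+1 => diff A i.+1 a = 0) (@coboundary A i.+1)
              (@bicocycle i.+1 0) (@cobd1 i 0).
Proof.
apply: (@subquot_iso_inj _ _ (e i.+1)).
- by move=> a a' a0 a'0; rewrite raddfB a0 a'0 subr0.
- move=> a a0; split; first by rewrite ed a0 raddf0.
  by apply/e_exact; exists a.
- move=> x [x1 /e_exact [a ax]]; exists a => //.
  by apply: (@e_inj i.+2); rewrite -ed ax x1 raddf0.
- move=> a a0 /=; split=> [[b <-]|[y /e_exact [b <-]]].
    by exists (e i b); [apply/e_exact; exists b | rewrite ed].
  by rewrite ed => /e_inj <-; exists b.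
Qed.

Let iso_B_bicocycle j :
  subquot_iso (fun b : B j.+1 => diff B j.+1 b = 0) (@coboundary B j.+1)
              (@bicocycle 0 j.+1) (@cobd2 0 j).
Proof.
apply: (@subquot_iso_inj _ _ (h j.+1)).
- by move=> a a' a0 a'0; rewrite raddfB a0 a'0 subr0.
- move=> b b0; split; last by rewrite hd b0 raddf0.
  by apply/h_exact; exists b.
- move=> x [/h_exact [b bx] x2]; exists b => //.
  by apply: (@h_inj j.+2); rewrite -hd bx x2 raddf0.
- move=> b b0 /=; split=> [[a <-]|[y /h_exact [a <-]]].
    by exists (h j a); [apply/h_exact; exists a | rewrite hd].
  by rewrite hd => /h_inj <-; exists a.
Qed.

(** Induction along the antidiagonal: [cobd12] replaces [cobd2] by [cobd1], then [zigzag] trades one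
    unit of [i] for one of [j]. The degree is a variable [n] so that no equation on [i + j] is
    transported through the type [A n.+1]. *)
Let iso_A_cobd2 j : forall i n, n = (i + j)%N ->
  subquot_iso (fun a : A n.+1 => diff A n.+1 a = 0) (@coboundary A n.+1)
              (@bicocycle i j.+1) (@cobd2 i j).
Proof.
elim: j => [|j IHj] i n ->.
  rewrite addn0; apply: subquot_iso_trans (iso_A_bicocycle i) _.
  by apply: subquot_iso_sym; apply: zigzag.
apply: (@subquot_iso_trans _ _ _ _ _ (@bicocycle i.+1 j.+1) (@cobd1 i j.+1)).
  apply: subquot_iso_sym.
  apply: (@subquot_iso_ext _ _ _ (@cobd2 i.+1 j)) => [x _|].
    exact: iff_sym (cobd12 x).
  by apply: subquot_iso_sym; apply: IHj; rewrite addnS.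
by apply: subquot_iso_sym; apply: zigzag.
Qed.

Lemma double_complex_cohomology n : zmod_iso (cohomology A n) (cohomology B n).
Proof.
apply: zmod_iso_cohomology; case: n => [|n].
  (* In degree 0 both cohomologies are the bicocycles of [K 0 0], with 0 as the only coboundary. *)
  apply: (@subquot_iso_trans _ _ _ _ _ (@bicocycle 0 0) (fun x => x = 0)).
    apply: (@subquot_iso_inj _ _ (e 0))
      => [a a' a0 a'0|a a0|x [x1 /e_exact [a ax]]|a _].
    - by rewrite raddfB a0 a'0 subr0.
    - by split; [rewrite ed a0 raddf0 | apply/e_exact; exists a].
    - by exists a => //; apply: (@e_inj 1); rewrite -ed ax x1 raddf0.
    - split=> /= [->|e0]; first by rewrite raddf0.
      by apply: (@e_inj 0); rewrite e0 raddf0.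
  apply: subquot_iso_sym.
  apply: (@subquot_iso_inj _ _ (h 0))
    => [b b' b0 b'0|b b0|x [/h_exact [b bx] x2]|b _].
  - by rewrite raddfB b0 b'0 subr0.
  - by split; [apply/h_exact; exists b | rewrite hd b0 raddf0].
  - by exists b => //; apply: (@h_inj 1); rewrite -hd bx x2 raddf0.
  - split=> /= [->|h0]; first by rewrite raddf0.
    by apply: (@h_inj 0); rewrite h0 raddf0.
apply: subquot_iso_trans (iso_A_cobd2 (erefl (0 + n)%N)) _.
by apply: subquot_iso_sym; apply: iso_B_bicocycle.
Qed.

End DoubleComplex.

(** * Faces and cochains with coefficients in a diagram *)

(** The term at [(k, l)] with [k <= l] cancels the one at [(l.+1, k)]: the values agree by
    hypothesis and the exponents have opposite parity. *)
Lemma alternating_sum_faces (V : zmodType) n (f : 'I_n.+3 -> 'I_n.+2 -> V) :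
  (forall k l : 'I_n.+2, (k <= l)%N ->
    f (widen_ord (leqnSn _) k) l = f (lift ord0 l) k) ->
  \sum_k \sum_l f k l *~ ((-1) ^+ (n.+2 - k) * (-1) ^+ (n.+1 - l)) = 0.
Proof.
move=> fC; pose g k l := f k l *~ ((-1) ^+ (n.+2 - k) * (-1) ^+ (n.+1 - l)).
transitivity
  (\sum_(k < n.+3) \sum_(l < n.+2) (if (k <= l)%N then g k l else 0)
   + \sum_(k < n.+3) \sum_(l < n.+2) (if (k <= l)%N then 0 else g k l)).
  rewrite -big_split; apply: eq_bigr => k _; rewrite -big_split.
  by apply: eq_bigr => l _ /=; case: ifP; rewrite ?addr0 ?add0r.
(* The first sum is taken with [l] outside; in the second the row [k = 0] vanishes, and its row
   [l.+1] is then matched with column [l] of the first. *)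
rewrite exchange_big [X in _ + X]big_ord_recl /=.
rewrite [X in _ + (X + _)]big1 // add0r -big_split; apply: big1 => l _.
rewrite /= big_ord_recr /= [(n.+2 <= l)%N]leqNgt ltn_ord /= addr0 -big_split.
apply: big1 => k _; rewrite /= /g /bump leq0n add1n [(l < k)%N]ltnNge.
case: ifP => kl; last by rewrite addr0.
rewrite fC // -mulrzDr -[RHS](mulr0z (f (lift ord0 l) k)); congr (_ *~ _).
rewrite -!exprD (_ : (n.+2 - k + (n.+1 - l) = (n.+2 - l.+1 + (n.+1 - k)).+1)%N).
  by rewrite exprS mulN1r addNr.
by have := ltn_ord l; lia.
Qed.

Section SimplexLikePoset.
Variables (disp : Order.disp_t) (P : porderType disp).
Hypothesis P_simplex_like : simplex_like P.

(** Both objects are faces of the one simplex below [t], where a face is determined by its vertices.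
    Without a common upper bound this fails: two edges may share both ends. *)
Lemma eq_below (t q q' : P) : (q <= t)%O -> (q' <= t)%O ->
  (forall w : Ob P 0, (val w <= q)%O <-> (val w <= q')%O) -> q = q'.
Proof.
move=> qt q't qq'; have [n /simplex_chart [u [g [_ _ gS _ [_ ug]]]]] := P_simplex_like t.
have [[A A0 qA] [B B0 qB]] := (gS _ qt, gS _ q't).
rewrite qA qB; congr g; apply/setP => i.
by rewrite -[LHS]ug // -[RHS]ug // -qA -qB; apply/idP/idP => /qq'.
Qed.

Lemma Ob_eq_below (t : P) n (q q' : Ob P n) :
  (val q <= t)%O -> (val q' <= t)%O ->
  (forall w : Ob P 0, (val w <= val q)%O <-> (val w <= val q')%O) -> q = q'.
Proof. by move=> qt q't qq'; apply: val_inj; apply: eq_below qt q't qq'. Qed.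

Variables (le0 : rel (Ob P 0)) (le0T : total_order le0).
Local Notation vertices := (vertices le0T).
Local Notation face := (face le0T).

Lemma le0_refl : reflexive le0.
Proof. by move=> x; have [/(_ x x)] := le0T; rewrite orbb. Qed.

Lemma vertices_mono n (p : Ob P n) i j :
  le0 (vertices p i) (vertices p j) = (i <= j)%N.
Proof. by have [] := verticesP le0T p. Qed.

Lemma le_verticesP n (p : Ob P n) (w : Ob P 0) :
  (val w <= val p)%O <-> exists i, w = vertices p i.
Proof. by have [] := verticesP le0T p. Qed.

Lemma vertices_inj n (p : Ob P n) : injective (vertices p).
Proof.
move=> i j e; apply/val_inj/eqP.
by rewrite eqn_leq -!(vertices_mono p) e le0_refl.
Qed.

Lemma vertices_le n (p : Ob P n) i : (val (vertices p i) <= val p)%O.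
Proof. by apply/le_verticesP; exists i. Qed.

(** Two increasing enumerations of one finite set coincide. *)
Lemma vertices_unique n (p : Ob P n) v :
  vertices_of le0 (val p) v -> v =1 vertices p.
Proof.
move=> [vmono vP]; have [_ tr anti] := le0T.
have vI : injective v.
  by move=> i j e; apply/val_inj/eqP; rewrite eqn_leq -!vmono e le0_refl.
have srt (u : 'I_n.+1 -> Ob P 0) :
    (forall i j, le0 (u i) (u j) = (i <= j)%N) ->
    sorted le0 (map u (enum 'I_n.+1)).
  move=> umono; rewrite sorted_map.
  rewrite (@eq_sorted _ _ (relpre val leq)) => [|i j]; last exact: umono.
  by rewrite -sorted_map val_enum_ord iota_sorted.
have : map v (enum 'I_n.+1) = map (vertices p) (enum 'I_n.+1).
  apply: (sorted_eq tr anti); [exact: srt | exact/srt/vertices_mono | ].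
  apply: uniq_perm; rewrite ?(map_inj_uniq vI) ?enum_uniq //.
    by rewrite (map_inj_uniq (@vertices_inj _ p)) enum_uniq.
  move=> w; apply/mapP/mapP => [[i _ wi]|[i _ wi]].
    have /le_verticesP [j wj] : (val w <= val p)%O by apply/vP; exists i.
    by exists j => //; rewrite mem_enum.
  have /vP [j wj] : (val w <= val p)%O by apply/le_verticesP; exists i.
  by exists j => //; rewrite mem_enum.
by move/eq_in_map => e i; apply: e; rewrite mem_enum.
Qed.

Lemma face_le n (p : Ob P n.+1) j : (val (face p j) <= val p)%O.
Proof. by have [] := faceP le0T p j. Qed.

(** Omitting the vertex [j] leaves an increasing enumeration, to which [vertices_unique] applies.
    Face identities thus reduce to identities between [lift]s. *)
Lemma vertices_face n (p : Ob P n.+1) (j : 'I_n.+2) i :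
  vertices (face p j) i = vertices p (lift j i).
Proof.
symmetry; apply: (vertices_unique (v := fun i => vertices p (lift j i))).
split=> [a b|w]; first by rewrite vertices_mono leq_bump2.
have [_ ->] := faceP le0T p j; split=> [[l]|[l ->]].
  by rewrite eq_sym; case: (unliftP j l) => [m -> _ ->|->]; [exists m | rewrite eqxx].
by exists (lift j l); rewrite // eq_sym neq_lift.
Qed.

Lemma le_faceP n (p : Ob P n.+1) (j : 'I_n.+2) (w : Ob P 0) :
  (val w <= val (face p j))%O <-> (val w <= val p)%O /\ w <> vertices p j.
Proof.
have [_ ->] := faceP le0T p j; rewrite le_verticesP.
split=> [[i ij ->]|[[i ->] wj]].
  by split; [exists i | move/vertices_inj/eqP; rewrite (negPf ij)].
by exists i => //; apply/eqP => e; apply: wj; rewrite e.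
Qed.

Lemma face_face n (p : Ob P n.+2) (k l : 'I_n.+2) : (k <= l)%N ->
  face (face p (widen_ord (leqnSn _) k)) l = face (face p (lift ord0 l)) k.
Proof.
move=> kl; apply: (Ob_eq_below (t := val p)).
- exact: le_trans (face_le _ _) (face_le _ _).
- exact: le_trans (face_le _ _) (face_le _ _).
have e i : lift (widen_ord (leqnSn _) k) (lift l i) = lift (lift ord0 l) (lift k i).
  by apply: val_inj; rewrite /= /bump; lia.
move=> w; rewrite !le_verticesP.
by split=> -[i ->]; exists i; rewrite !vertices_face e.
Qed.

Section Cochains.
Variable F : diagram P.

Definition cochains n : zmodType := dprod (fun q : Ob P n => F (val q)).

(** Signs count from the last vertex: the face opposite to it has sign +1, which suits cones over
    the last vertex. *)
Definition cochain_diff n (x : cochains n) : cochains n.+1 := fun p =>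
  \sum_(j < n.+2) arr F (face_le p j) (x (face p j)) *~ ((-1) ^+ (n.+1 - j)).

Lemma cochain_diff_additive n : zmod_morphism (@cochain_diff n).
Proof.
move=> x y; apply: functional_extensionality_dep => p.
rewrite -[RHS]/(cochain_diff x p - cochain_diff y p) -sumrB.
apply: eq_bigr => j _.
by rewrite -[(x - y) _]/(x (face p j) - y (face p j)) raddfB mulrzBl.
Qed.
HB.instance Definition _ n :=
  GRing.isZmodMorphism.Build _ _ (@cochain_diff n) (@cochain_diff_additive n).

Lemma cochain_diffK n (x : cochains n) : cochain_diff (cochain_diff x) = 0.
Proof.
apply: functional_extensionality_dep => p; rewrite -[RHS]/0.
(* The values of [x] are moved into the single group [F (val p)], with 0 off the simplex [p], so
   that equal faces can be rewritten without casts between groups. *)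
pose xp (q : Ob P n) : F (val p) :=
  if @idP (val q <= val p)%O is ReflectT qp then arr F qp (x q) else 0.
have xpE q (qp : (val q <= val p)%O) : xp q = arr F qp (x q).
  rewrite /xp; case: {-}_ / idP => [qp'|//].
  by rewrite (bool_irrelevance qp' qp).
rewrite -(@alternating_sum_faces _ _ (fun k l => xp (face (face p k) l))).
  apply: eq_bigr => k _; rewrite raddf_sum mulrz_suml; apply: eq_bigr => l _.
  rewrite raddfMz -mulrzA [X in _ *~ X]mulrC xpE => [|pf].
    exact: le_trans (face_le _ _) (face_le _ _).
  by rewrite (arr_comp _ _ pf).
by move=> k l /face_face ->.
Qed.

End Cochains.

Definition cochain_map (F G : diagram P) (t : nat_trans F G) n
  (x : cochains F n) : cochains G n := fun q => t (val q) (x q).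

Lemma cochain_map_additive F G t n : zmod_morphism (@cochain_map F G t n).
Proof.
move=> x y; apply: functional_extensionality_dep => q.
exact: raddfB.
Qed.
HB.instance Definition _ F G t n :=
  GRing.isZmodMorphism.Build _ _ (@cochain_map F G t n)
    (@cochain_map_additive F G t n).

Lemma cochain_diff_map (F G : diagram P) (t : nat_trans F G) n (x : cochains F n) :
  cochain_diff (cochain_map t x) = cochain_map t (cochain_diff x).
Proof.
apply: functional_extensionality_dep => p; rewrite /cochain_map raddf_sum.
by apply: eq_bigr => j _; rewrite raddfMz naturality.
Qed.

End SimplexLikePoset.

(** * Contractibility of a simplex *)

Section Cone.
Variables (disp : Order.disp_t) (P : porderType disp).
Hypothesis P_simplex_like : simplex_like P.
Variables (le0 : rel (Ob P 0)) (le0T : total_order le0).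
Local Notation vertices := (vertices le0T).
Local Notation face := (face le0T).

Definition is_last_vertex (t : P) (v : Ob P 0) : Prop :=
  (val v <= t)%O /\ forall w : Ob P 0, (val w <= t)%O -> le0 w v.

Lemma last_vertex_ex t : exists v, is_last_vertex t v.
Proof.
have [n /asboolT tn] := P_simplex_like t.
pose p : Ob P n := exist _ t tn.
exists (vertices p ord_max); split=> [|w]; first exact: (vertices_le le0T p).
by move=> /(le_verticesP le0T p) [i ->]; rewrite vertices_mono leq_ord.
Qed.

Variables (t : P) (v : Ob P 0).
Hypothesis last_v : is_last_vertex t v.

(* [r] is the join [v * q] inside the simplex [t]. *)
Definition is_cone n (q : Ob P n) (r : Ob P n.+1) : Prop :=
  (val r <= t)%O /\
  forall w : Ob P 0, (val w <= val r)%O <-> (val w <= val q)%O \/ w = v.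

(** In the chart of [t], if [q] is the face [A] and [v] the vertex [i], the cone is the face
    [i |: A]. *)
Lemma cone_ex n (q : Ob P n) :
  (val q <= t)%O -> ~ (val v <= val q)%O -> exists r, is_cone q r.
Proof.
move=> qt vq; have [vt _] := last_v.
have [d /simplex_chart [u [g [uI uP gS gp [gle ug]]]]] := P_simplex_like t.
have [A A0 qA] := gS _ qt; have /uP [i vi] := vt.
have iA0 : i |: A != set0 by apply/set0Pn; exists i; rewrite !inE eqxx.
have rP (w : Ob P 0) :
    (val w <= g (i |: A))%O <-> (val w <= val q)%O \/ w = v.
  split=> [wr|].
    have /uP [k wk] := le_trans wr (gp _ iA0).
    move: wr; rewrite wk ug // !inE qA ug // => /orP [/eqP -> |]; last by left.
    by right.
  case=> [wq|->]; last by rewrite vi ug // !inE eqxx.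
  have /uP [k wk] := le_trans wq qt.
  by move: wq; rewrite wk qA !ug // !inE orbC => ->.
(* Only some degree [m] is known at first; counting vertices, those of [q] together with [v], gives
   [m = n.+1]. *)
have [m rm] := P_simplex_like (g (i |: A)).
have [u' [_ [u'I u'P _ _ _]]] := simplex_chart rm.
suff em : m = n.+1.
  rewrite em in rm.
  exists (exist _ (g (i |: A)) (asboolT rm) : Ob P n.+1); split=> //=.
  exact: gp.
have /perm_size : perm_eq (codom u') (v :: codom (vertices q)).
  apply: uniq_perm => [| |w].
  - by rewrite map_inj_uniq ?enum_uniq.
  - rewrite /= map_inj_uniq ?enum_uniq ?andbT; last exact: vertices_inj.
    by apply/negP => /codomP [k vk]; apply: vq; rewrite vk vertices_le.
  - rewrite inE; apply/codomP/orP => [/u'P /rP [|->]|].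
    + by move=> /(le_verticesP le0T) [k ->]; right; apply: codom_f.
    + by left.
    + case=> [/eqP ->|/codomP [k ->]]; apply/u'P/rP; first by right.
      by left; apply: vertices_le.
by rewrite /= !size_codom !card_ord => -[].
Qed.

Lemma cone_unique n (q : Ob P n) r r' : is_cone q r -> is_cone q r' -> r = r'.
Proof.
move=> [rt rP] [r't r'P].
by apply: (Ob_eq_below P_simplex_like rt r't) => w; rewrite rP r'P.
Qed.

Lemma last_vertexE n (r : Ob P n) :
  (val r <= t)%O -> (val v <= val r)%O -> vertices r ord_max = v.
Proof.
move=> rt /(le_verticesP le0T) [k vk]; have [_ vmax] := last_v.
have := vmax _ (le_trans (vertices_le le0T r ord_max) rt).
rewrite vk vertices_mono /= => nk; congr (vertices r _); apply: val_inj => /=.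
by apply/eqP; rewrite eqn_leq nk leq_ord.
Qed.

Lemma cone_apex n (q : Ob P n) r : is_cone q r -> vertices r ord_max = v.
Proof. by move=> [rt rP]; apply: last_vertexE => //; apply/rP; right. Qed.

Lemma cone_base n (q : Ob P n) r : (val q <= t)%O ->
  is_cone q r -> ~ (val v <= val q)%O -> face r ord_max = q.
Proof.
move=> qt qr vq; have [rt rP] := qr.
apply: (Ob_eq_below P_simplex_like _ qt); first exact: le_trans (face_le _ _ _) rt.
move=> w; rewrite le_faceP (cone_apex qr) rP.
by split=> [[[]//]|wq]; split=> [|wv]; [left | apply: vq; rewrite -wv].
Qed.

Lemma face_cone n (r : Ob P n.+1) :
  (val r <= t)%O -> (val v <= val r)%O -> is_cone (face r ord_max) r.
Proof.
move=> rt vr; split=> // w; rewrite le_faceP last_vertexE //.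
split=> [wr|[[]//|->//]].
by have [->|/eqP wv] := eqVneq w v; [right | left].
Qed.

(** Since [v] is the last vertex, joining it leaves the indices of the others unchanged, hence the
    same [j] on both sides. *)
Lemma cone_face n (q : Ob P n.+1) r (j : 'I_n.+2) : (val q <= t)%O ->
  is_cone q r -> ~ (val v <= val q)%O ->
  is_cone (face q j) (face r (widen_ord (leqnSn _) j)).
Proof.
move=> qt qr vq; have [rt rP] := qr.
split=> [|w]; first exact: le_trans (face_le _ _ _) rt.
have rj : vertices r (widen_ord (leqnSn _) j) = vertices q j.
  rewrite -[in RHS](cone_base qt qr vq) vertices_face; congr (vertices r _).
  by apply: val_inj; rewrite /= /bump leqNgt ltn_ord.
rewrite !le_faceP rj rP; split=> [[[wq|->]]|[[wq wz]|->]]; try tauto.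
by split; [right | move=> vz; apply: vq; rewrite vz vertices_le].
Qed.

Section Exactness.
Variable V : zmodType.

(** A cochain of the simplex below [t] is represented by a function on all of [Ob P n], whose values
    off the simplex are ignored. *)
Definition const_diff n (x : Ob P n -> V) (p : Ob P n.+1) : V :=
  \sum_(j < n.+2) x (face p j) *~ ((-1) ^+ (n.+1 - j)).

(** The edge joining [w] to [v] has these two vertices as its faces, so the cocycle condition on it
    reads [x w = x v]. *)
Lemma simplex_exact0 (x : Ob P 0 -> V) :
  (forall r : Ob P 1, (val r <= t)%O -> const_diff x r = 0) ->
  forall w : Ob P 0, (val w <= t)%O -> x w = x v.
Proof.
move=> dx w wt; have [->//|/eqP wv] := eqVneq w v.
have min (z u : Ob P 0) : (val z <= val u)%O <-> z = u.
  split=> [|->]; last exact: lexx.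
  by have /asboolP/has_deg0P um := valP u => /um; apply: val_inj.
have vw : ~ (val v <= val w)%O by move/min => vw; apply: wv.
have [r wr] := cone_ex wt vw; have [rt rP] := wr.
have face1 : face r (lift ord0 ord0) = w.
  by rewrite -(cone_base wt wr vw); congr (face r _); apply: val_inj.
have vertex0 : vertices r ord0 = w.
  have /(le_verticesP le0T) [k wk] : (val w <= val r)%O by apply/rP; left; apply/min.
  case: (unliftP ord_max k) => [l kl|kmax].
    by rewrite wk kl; congr (vertices r _); apply: val_inj; rewrite (ord1 l).
  by case: wv; rewrite wk kmax (cone_apex wr).
have face0 : face r ord0 = v.
  apply: (Ob_eq_below P_simplex_like (t := t)) => [||z].
  - exact: le_trans (face_le _ _ _) rt.
  - by have [] := last_v.
  - rewrite le_faceP vertex0 rP !min.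
    by split=> [[[]//]|->]; split; [right | move/esym].
have := dx r rt; rewrite /const_diff big_ord_recl big_ord1 face1 face0.
by rewrite mulrNz mulr1z mulr1z => /eqP; rewrite addrC subr_eq0 => /eqP.
Qed.

(** The contracting homotopy of a cone: [y q] is [x] at the cone over [q] if [v] is not a vertex of
    [q], and 0 otherwise. *)
Lemma simplex_exact n (x : Ob P n.+1 -> V) :
  (forall r : Ob P n.+2, (val r <= t)%O -> const_diff x r = 0) ->
  exists y : Ob P n -> V,
    forall q : Ob P n.+1, (val q <= t)%O -> const_diff y q = x q.
Proof.
move=> dx.
have [y yP] : {y : Ob P n -> V & forall q, (val q <= t)%O ->
    ((val v <= val q)%O -> y q = 0) /\
    (~ (val v <= val q)%O -> forall r, is_cone q r -> y q = x r)}.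
  apply: (@choice _ _ (fun q yq => (val q <= t)%O ->
    ((val v <= val q)%O -> yq = 0) /\
    (~ (val v <= val q)%O -> forall r, is_cone q r -> yq = x r))) => q.
  have [vq|/negP vq] := boolP (val v <= val q)%O.
    by exists 0 => _; split=> // /(_ vq).
  have [[r qr]|nr] := pselect (exists r, is_cone q r).
    by exists (x r) => qt; split=> // _ r' /(cone_unique qr) ->.
  (* By [cone_ex] this happens only if [q] is not below [t]; the value 0 is then arbitrary. *)
  by exists 0 => qt; split=> // _ r qr; case: nr; exists r.
exists y => q qt.
have yj j := yP (face q j) (le_trans (face_le le0T q j) qt).
have [vq|/negP vq] := boolP (val v <= val q)%O.
  (* All faces but the one opposite to [v] contain [v] and contribute 0; the cone over the remaining
     one is [q] itself. *)
  rewrite /const_diff big_ord_recr /= subnn mulr1z big1 ?add0r => [|j _].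
    have [_] := yj ord_max; apply; last exact: face_cone.
    by rewrite le_faceP last_vertexE // => -[].
  have [y0 _] := yj (widen_ord (leqnSn _) j).
  rewrite y0 ?mul0rz // le_faceP; split=> //; rewrite -{1}(last_vertexE qt vq).
  move/vertices_inj/(congr1 val) => /= e.
  by have := ltn_ord j; rewrite -e ltnn.
have [r qr] := cone_ex qt vq; have [rt _] := qr.
(* The cocycle condition on the cone [r] expresses [x q], the value at its last face, through the
   cones over the faces of [q]. *)
have := dx r rt; rewrite /const_diff big_ord_recr /= subnn mulr1z (cone_base qt qr vq).
move=> /eqP; rewrite addrC addr_eq0 => /eqP ->; rewrite -sumrN.
apply: eq_bigr => j _.
have [_ yc] := yj j; rewrite (yc _ _ (cone_face j qt qr vq)); last first.
  by rewrite le_faceP => -[].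
by rewrite -mulrNz (subSn (leq_ord j)) exprS mulN1r opprK.
Qed.

End Exactness.
End Cone.

(** * Acyclic diagrams *)

Section DprodEvaluation.
Variables (I : Type) (F : I -> zmodType) (i : I).

Definition dprod_eval (x : dprod F) : F i := x i.

Lemma dprod_eval_additive : zmod_morphism dprod_eval.
Proof. by []. Qed.
HB.instance Definition _ :=
  GRing.isZmodMorphism.Build _ _ dprod_eval dprod_eval_additive.

End DprodEvaluation.

Section Coinduced.
Variables (disp : Order.disp_t) (P : porderType disp).
Variables (I : Type) (t : I -> P) (A : I -> zmodType).

(** The right Kan extension of the family [A] along [t], with [I] as a discrete category. *)
Definition coinduced_obj (p : P) : zmodType :=
  dprod (fun i : {i : I | (p <= t i)%O} => A (sval i)).

Definition coinduced_arr (p q : P) (pq : (p <= q)%O) (x : coinduced_obj p) :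
  coinduced_obj q := fun i => x (exist _ (sval i) (le_trans pq (svalP i))).

Lemma coinduced_arr_additive p q pq : zmod_morphism (@coinduced_arr p q pq).
Proof. by move=> x y; apply: functional_extensionality_dep. Qed.
HB.instance Definition _ p q pq :=
  GRing.isZmodMorphism.Build _ _ (@coinduced_arr p q pq)
    (@coinduced_arr_additive p q pq).

Lemma coinduced_arr_id p (pp : (p <= p)%O) x : coinduced_arr pp x = x.
Proof.
apply: functional_extensionality_dep => -[i pi]; rewrite /coinduced_arr /=.
by rewrite (bool_irrelevance (le_trans _ _) pi).
Qed.

Lemma coinduced_arr_comp (p q r : P) (pq : (p <= q)%O) (qr : (q <= r)%O)
  (pr : (p <= r)%O) x :
  coinduced_arr qr (coinduced_arr pq x) = coinduced_arr pr x.
Proof.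
apply: functional_extensionality_dep => -[i ri]; rewrite /coinduced_arr /=.
congr (x (exist _ i _)); exact: bool_irrelevance.
Qed.

Definition coinduced : diagram P :=
  Diagram (obj := coinduced_obj) (arr := fun p q pq => @coinduced_arr p q pq)
    coinduced_arr_id coinduced_arr_comp.

End Coinduced.

Section Acyclic.
Variables (disp : Order.disp_t) (P : porderType disp).
Hypothesis P_simplex_like : simplex_like P.
Variables (le0 : rel (Ob P 0)) (le0T : total_order le0).

Definition lim_cochain (F : diagram P) (z : lim F) : cochains F 0 :=
  fun q => val z (val q).

Lemma lim_cochain_additive F : zmod_morphism (@lim_cochain F).
Proof. by move=> x y; apply: functional_extensionality_dep. Qed.
HB.instance Definition _ F :=
  GRing.isZmodMorphism.Build _ _ (@lim_cochain F) (@lim_cochain_additive F).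

(** Each value of a compatible family is the image of its value at any vertex below. *)
Lemma lim_cochain_inj F : injective (@lim_cochain F).
Proof.
move=> z z' e; apply: val_inj; apply: functional_extensionality_dep => p.
have [v [vp _]] := last_vertex_ex P_simplex_like le0T p.
have /asboolP/(_ _ _ vp) <- := valP z.
have /asboolP/(_ _ _ vp) <- := valP z'.
by rewrite -[val z _]/(lim_cochain z v) e.
Qed.

Lemma cochain_diff_lim F (z : lim F) : cochain_diff le0T (lim_cochain z) = 0.
Proof.
apply: functional_extensionality_dep => p; rewrite /cochain_diff.
have /asboolP zc := valP z.
by rewrite big_ord_recl big_ord1 !zc mulrNz addNr.
Qed.

(** Together with [lim_cochain_inj], [cochain_diff_lim] and [cochain_diffK], this is exactness of
    [0 -> lim F -> C^0 F -> C^1 F -> ...]. *)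
Definition acyclic (F : diagram P) : Prop :=
  (forall x : cochains F 0, cochain_diff le0T x = 0 ->
     exists z, lim_cochain z = x) /\
  (forall n (x : cochains F n.+1), cochain_diff le0T x = 0 ->
     exists y, cochain_diff le0T y = x).

(** A cocycle is pushed to [G] by [m], solved there, and the solution is brought back by [r]. *)
Lemma retract_acyclic (F G : diagram P) (m : nat_trans F G) (r : nat_trans G F) :
  (forall p x, r p (m p x) = x) -> acyclic G -> acyclic F.
Proof.
move=> rm [G0 GS].
have rmK n (x : cochains F n) : cochain_map r (cochain_map m x) = x.
  by apply: functional_extensionality_dep => q; apply: rm.
split=> [|n] x dx; have mx0 : cochain_diff le0T (cochain_map m x) = 0
  by rewrite cochain_diff_map dx raddf0.
  have [z zx] := G0 _ mx0; exists (lim_map r z).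
  by rewrite -[RHS]rmK -zx.
have [y yx] := GS _ _ mx0; exists (cochain_map r y).
by rewrite cochain_diff_map yx rmK.
Qed.

Section CoinducedAcyclic.
Variables (I : Type) (t : I -> P) (A : I -> zmodType).
Let E := coinduced t A.

Let component n (x : cochains E n) i (q : Ob P n) : A i :=
  if @idP (val q <= t i)%O is ReflectT qi then x q (exist _ i qi) else 0.

Let componentE n (x : cochains E n) i q (qi : (val q <= t i)%O) :
  component x i q = x q (exist _ i qi).
Proof.
rewrite /component; case: {-}_ / idP => [qi'|//].
by rewrite (bool_irrelevance qi' qi).
Qed.

Let coinduced_diffE n (x : cochains E n) p i (pi : (val p <= t i)%O) :
  cochain_diff le0T x p (exist _ i pi) = const_diff le0T (component x i) p.
Proof.
rewrite -[LHS]/(dprod_eval _ _) raddf_sum; apply: eq_bigr => j _.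
rewrite raddfMz; congr (_ *~ _).
exact/esym/componentE.
Qed.

Lemma coinduced_acyclic : acyclic E.
Proof.
have cocycle_component n (x : cochains E n) : cochain_diff le0T x = 0 ->
    forall i r, (val r <= t i)%O -> const_diff le0T (component x i) r = 0.
  by move=> dx i r ri; rewrite -(coinduced_diffE x ri) dx.
split=> [x dx|n x dx].
  pose v i := sval (cid (last_vertex_ex P_simplex_like le0T (t i))).
  have vP i : is_last_vertex le0 (t i) (v i) := svalP (cid _).
  (* By [simplex_exact0] each component is constant on its simplex; the value at the last vertex of
     [t i] does not depend on [p], which makes [z] compatible. *)
  pose z : dprod E := fun p i => component x (sval i) (v (sval i)).
  have zc : z \in @compatible _ _ E.
    by apply/asboolP => p q pq; apply: functional_extensionality_dep.
  exists (Lim zc); apply: functional_extensionality_dep => q.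
  apply: functional_extensionality_dep => -[i qi].
  rewrite /lim_cochain /= /z /= -componentE; symmetry.
  by apply: (simplex_exact0 P_simplex_like (vP i) (cocycle_component _ x dx i)).
have ex i := let: exist v vP := cid (last_vertex_ex P_simplex_like le0T (t i)) in
  simplex_exact P_simplex_like vP (cocycle_component _ x dx i).
pose y i := sval (cid (ex i)).
have yP i q : (val q <= t i)%O -> const_diff le0T (y i) q = component x i q
  := svalP (cid (ex i)) q.
pose Y : cochains E n := fun q i => y (sval i) q.
exists Y; apply: functional_extensionality_dep => q.
apply: functional_extensionality_dep => -[i qi].
rewrite coinduced_diffE -componentE -yP //; apply: eq_bigr => j _.
by rewrite (@componentE _ Y i _ (le_trans (face_le le0T q j) qi)).
Qed.

End CoinducedAcyclic.

(* [J] is a retract of the coinduced diagram [p |-> prod_(i >= p) J i]. *)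
Lemma injective_acyclic (J : diagram P) : injective_diagram J -> acyclic J.
Proof.
move=> Jinj; pose E := coinduced id J.
pose m p (x : J p) : E p := fun i => arr J (svalP i) x.
have mB p : zmod_morphism (m p).
  by move=> x y; apply: functional_extensionality_dep => i; apply: raddfB.
pose mA p : {additive J p -> E p} :=
  HB.pack (m p) (GRing.isZmodMorphism.Build _ _ _ (mB p)).
have mN (p q : P) (pq : (p <= q)%O) x : mA q (arr J pq x) = arr E pq (mA p x).
  apply: functional_extensionality_dep => -[i qi].
  by rewrite /= /m /= /coinduced_arr /=; apply: arr_comp.
have idN (p q : P) (pq : (p <= q)%O) x :
  (fun p => (idfun : {additive J p -> J p})) q (arr J pq x) = arr J pq x by [].
(* Injectivity of [J] extends the identity of [J] along [m] to a retraction; [m] is injective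
   because its coordinate at [p] itself is the identity. *)
have [p x y mxy|r rm] := Jinj _ _ (NatTrans mN) (NatTrans idN).
  have := congr1 (fun f : E p => f (exist _ p (lexx p))) mxy.
  by rewrite /= /m /= !arr_id.
exact: retract_acyclic rm (coinduced_acyclic _ _).
Qed.

End Acyclic.

(** * Comparison with derived limits and with the nerve *)

Section Comparison.
Variables (disp : Order.disp_t) (P : porderType disp).
Hypothesis P_simplex_like : simplex_like P.
Variables (le0 : rel (Ob P 0)) (le0T : total_order le0).

Definition simplicial_diff n (x : Ob P n -> int) (p : Ob P n.+1) : int :=
  \sum_(j < n.+2) (-1) ^+ (n.+1 - j) * x (face le0T p j).

Lemma simplicial_diff_additive n : zmod_morphism (@simplicial_diff n).
Proof.
move=> x y; apply/funext => p.
rewrite -[RHS]/(simplicial_diff x p - simplicial_diff y p) -sumrB.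
by apply: eq_bigr => j _; rewrite -mulrBr.
Qed.
HB.instance Definition _ n :=
  GRing.isZmodMorphism.Build _ _ (@simplicial_diff n) (@simplicial_diff_additive n).

Lemma simplicial_diffE n (x : Ob P n -> int) :
  simplicial_diff x = cochain_diff le0T (F := constZ P) x.
Proof.
apply: functional_extensionality_dep => p.
by apply: eq_bigr => j _; rewrite mulrzz mulrC.
Qed.

Lemma simplicial_diffK n (x : Ob P n -> int) :
  simplicial_diff (simplicial_diff x) = 0.
Proof.
rewrite !simplicial_diffE.
exact: (cochain_diffK P_simplex_like le0T (F := constZ P)).
Qed.

Definition simplicial_cochains : cochain_complex :=
  @CochainComplex (fun n => Ob P n -> int) (fun n => @simplicial_diff n)
    simplicial_diffK.

(** * Cohomology computed by an acyclic resolution *)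

Section Resolution.
Variables (R : nat -> diagram P) (dR : forall n, nat_trans (R n) (R n.+1))
  (aug : nat_trans (constZ P) (R 0)).
Hypotheses (R_acyclic : forall n, acyclic le0T (R n))
  (aug_inj : forall p, injective (aug p))
  (R_exact0 : forall p x, dR 0 p x = 0 <-> exists a, aug p a = x)
  (R_exact : forall n p x, dR n.+1 p x = 0 <-> exists y, dR n p y = x).
Variables (B : cochain_complex) (h : forall n, {additive B n -> cochains (R n) 0}).
Hypotheses (h_inj : forall n, injective (h n))
  (h_exact : forall n x, cochain_diff le0T x = 0 <-> exists b, h n b = x)
  (hd : forall n b, cochain_map (dR n) (h n b) = h n.+1 (diff B n b)).

Let augment n (x : Ob P n -> int) : cochains (R 0) n :=
  cochain_map aug (x : cochains (constZ P) n).

Let augment_additive n : zmod_morphism (@augment n).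
Proof.
move=> x y; apply: functional_extensionality_dep => p.
exact: (raddfB (aug (val p))).
Qed.
HB.instance Definition _ n :=
  GRing.isZmodMorphism.Build _ _ (@augment n) (@augment_additive n).

(** [B] stands for the limits of the resolution, known only through [h], so that both models of
    cohomology fit. Acyclicity gives exactness for [cochain_diff], the resolution gives it for
    [cochain_map]. *)
Lemma resolution_cohomology n :
  zmod_iso (cohomology simplicial_cochains n) (cohomology B n).
Proof.
apply: (@double_complex_cohomology simplicial_cochains B
  (fun i j => cochains (R j) i)
  (fun i j => @cochain_diff _ _ _ le0T (R j) i)
  (fun i j => @cochain_map _ _ _ _ (dR j) i) augment h) => //.
- by move=> i j x; apply: cochain_diff_map.
- move=> i j x; split=> [|[y <-]]; last exact: cochain_diffK.
  by have [_] := R_acyclic j; apply.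
(* Exactness holds at each [q] separately; choice assembles the preimages into a cochain. *)
- move=> i j x; split=> [dx|[y <-]].
    have ex q : exists y, dR j (val q) y = x q.
      by apply/R_exact; exact: (congr1 (dprod_eval q) dx).
    exists (fun q => sval (cid (ex q))).
    by apply: functional_extensionality_dep => q; apply: svalP (cid (ex q)).
  apply: functional_extensionality_dep => q.
  by apply/R_exact; exists (y q).
- move=> i x y exy; apply: functional_extensionality_dep => q.
  by apply: (@aug_inj (val q)); apply: (congr1 (dprod_eval q) exy).
- move=> i x; split=> [dx|[y <-]].
    have ex q : exists y, aug (val q) y = x q.
      by apply/R_exact0; exact: (congr1 (dprod_eval q) dx).
    exists (fun q => sval (cid (ex q))).
    by apply: functional_extensionality_dep => q; apply: svalP (cid (ex q)).
  apply: functional_extensionality_dep => q.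
  by apply/R_exact0; exists (y q).
- move=> i x; rewrite /= /augment simplicial_diffE.
  exact: cochain_diff_map.
Qed.

End Resolution.

Lemma lim_complex_cohomology (R : injective_resolution (constZ P)) n :
  zmod_iso (cohomology simplicial_cochains n) (cohomology (lim_complex R) n).
Proof.
apply: (@resolution_cohomology (res R) (res_diff R) (res_aug R) _ _ _ _
  (lim_complex R) (fun n => @lim_cochain _ _ (res R n))).
- by move=> m; apply: injective_acyclic => //; apply: res_injective.
- exact: res_aug_inj.
- exact: res_exact0.
- exact: res_exact.
- by move=> m; apply: (lim_cochain_inj P_simplex_like le0T).
- move=> m x; split=> [|[z <-]]; last exact: cochain_diff_lim.
  by have [/(_ x)] := injective_acyclic P_simplex_like le0T (@res_injective _ _ _ R m).
- by [].
Qed.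

(** * The nerve and the resolution of the constant diagram by its cochains *)

Definition nerve_source n (c : nerve P n) : P := val c ord0.

Lemma nerve_mono n (c : nerve P n) (i j : 'I_n.+1) :
  (i <= j)%N -> (val c i <= val c j)%O.
Proof. by have /forallP/(_ i)/forallP/(_ j)/implyP := valP c. Qed.

Lemma nerve_source_face n (c : nerve P n.+1) k :
  (nerve_source c <= nerve_source (nerve_face k c))%O.
Proof. by rewrite /nerve_source /= ffunE; apply: nerve_mono. Qed.

Lemma le_source_face p n (c : nerve P n.+1) k :
  (p <= nerve_source c)%O -> (p <= nerve_source (nerve_face k c))%O.
Proof. by move=> pc; apply: le_trans pc (nerve_source_face c k). Qed.

Lemma nerve_cons_subproof p n (c : nerve P n) (pc : (p <= nerve_source c)%O) :
  [forall i : 'I_n.+2, forall j : 'I_n.+2, (i <= j)%N ==>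
    ([ffun i => if unlift ord0 i is Some k then val c k else p] i <=
     [ffun i => if unlift ord0 i is Some k then val c k else p] j)%O].
Proof.
apply/forallP=> i; apply/forallP=> j; apply/implyP; rewrite !ffunE.
case: (unliftP ord0 i) => [i' ->|->]; case: (unliftP ord0 j) => [j' ->|->] //= ij.
  by apply: nerve_mono; rewrite /bump !leq0n in ij.
by apply: le_trans pc (nerve_mono _ _).
Qed.

(** Prepending [p] is the cone operator contracting the nerve of [{q | p <= q}] to its least
    element. *)
Definition nerve_cons p n (c : nerve P n) (pc : (p <= nerve_source c)%O) :
  nerve P n.+1 := Sub [ffun i => _] (nerve_cons_subproof pc).

Lemma source_nerve_cons p n (c : nerve P n) (pc : (p <= nerve_source c)%O) :
  nerve_source (nerve_cons pc) = p.
Proof. by rewrite /nerve_source /= ffunE unlift_none. Qed.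

Lemma face_nerve_cons0 p n (c : nerve P n) (pc : (p <= nerve_source c)%O) :
  nerve_face ord0 (nerve_cons pc) = c.
Proof. by apply/val_inj/ffunP => i; rewrite /= !ffunE liftK. Qed.

Lemma face_nerve_consS p n (c : nerve P n.+1) (pc : (p <= nerve_source c)%O) k
    (pk : (p <= nerve_source (nerve_face k c))%O) :
  nerve_face (lift ord0 k) (nerve_cons pc) = nerve_cons pk.
Proof.
apply/val_inj/ffunP => i; rewrite /= !ffunE.
case: (unliftP ord0 i) => [j ->|->].
  have -> : lift (lift ord0 k) (lift ord0 j) = lift ord0 (lift k j).
    by apply: val_inj; rewrite /= /bump; lia.
  by rewrite liftK ffunE.
have -> : lift (lift ord0 k) ord0 = ord0 by apply: val_inj.
by rewrite unlift_none.
Qed.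

(* [godement n p] is the group of [n]-cochains of the nerve of [{q | p <= q}]. *)
Definition godement n : diagram P :=
  coinduced (@nerve_source n) (fun=> int : zmodType).

Lemma godement_irr n p (x : godement n p) c c' pc pc' :
  c = c' -> x (exist _ c pc) = x (exist _ c' pc').
Proof. by move=> cc'; rewrite -cc' in pc' *; rewrite (bool_irrelevance pc' pc). Qed.

(** Extension by zero to the whole nerve, so that [nerve_diff] and [nerve_diffK] apply. By
    [le_source_face] the default is never reached at a face of a simplex whose source is above
    [p]. *)
Definition godement_ext n p (x : godement n p) (c : nerve P n) : int :=
  if @idP (p <= nerve_source c)%O is ReflectT pc then x (exist _ c pc) else 0.

Lemma godement_extE n p (x : godement n p) c (pc : (p <= nerve_source c)%O) :
  godement_ext x c = x (exist _ c pc).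
Proof.
by rewrite /godement_ext; case: {-}_ / idP => [pc'|//]; apply: godement_irr.
Qed.

Definition godement_diff n p (x : godement n p) : godement n.+1 p :=
  fun c => nerve_diff (godement_ext x) (sval c).

Lemma godement_diffE n p (x : godement n p) c (pc : (p <= nerve_source c)%O) :
  godement_diff x (exist _ c pc) =
  \sum_(k < n.+2) (-1) ^+ k * x (exist _ (nerve_face k c) (le_source_face k pc)).
Proof. by apply: eq_bigr => k _; rewrite (godement_extE _ (le_source_face k pc)). Qed.

Lemma godement_diff_additive n p : zmod_morphism (@godement_diff n p).
Proof.
move=> x y; apply: functional_extensionality_dep => -[c pc].
rewrite -[RHS]/(godement_diff x _ - godement_diff y _) !godement_diffE -sumrB.
by apply: eq_bigr => k _; rewrite -mulrBr.
Qed.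
HB.instance Definition _ n p :=
  GRing.isZmodMorphism.Build _ _ (@godement_diff n p) (@godement_diff_additive n p).

Lemma godement_diff_natural n (p q : P) (pq : (p <= q)%O) (x : godement n p) :
  godement_diff (arr (godement n) pq x) = arr (godement n.+1) pq (godement_diff x).
Proof.
apply: functional_extensionality_dep => -[c qc].
rewrite godement_diffE; symmetry; apply: etrans (godement_diffE _ _) _.
by apply: eq_bigr => k _; congr (_ * _); apply: godement_irr.
Qed.

Definition godement_trans n : nat_trans (godement n) (godement n.+1) :=
  NatTrans (app := fun p => @godement_diff n p) (@godement_diff_natural n).

Definition godement_const p (a : int) : godement 0 p := fun=> a.

Lemma godement_const_additive p : zmod_morphism (@godement_const p).
Proof. by []. Qed.
HB.instance Definition _ p :=
  GRing.isZmodMorphism.Build _ _ (@godement_const p) (@godement_const_additive p).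

Definition godement_aug : nat_trans (constZ P) (godement 0) :=
  @NatTrans _ _ (constZ P) (godement 0) (fun p => @godement_const p)
    (fun _ _ _ _ => erefl).

Lemma nerve0_subproof (p : P) : [forall i : 'I_1, forall j : 'I_1, (i <= j)%N ==>
  ([ffun=> p] i <= [ffun=> p] j)%O].
Proof. by apply/forallP=> i; apply/forallP=> j; rewrite !ffunE lexx implybT. Qed.

Definition nerve0 p : nerve P 0 := Sub [ffun=> p] (nerve0_subproof p).

Lemma le_source_nerve0 p : (p <= nerve_source (nerve0 p))%O.
Proof. by rewrite /nerve_source ffunE. Qed.

Lemma le_source_cons p n (c : nerve P n) (pc : (p <= nerve_source c)%O) :
  (p <= nerve_source (nerve_cons pc))%O.
Proof. by rewrite source_nerve_cons. Qed.

Lemma godement_aug_inj p : injective (godement_aug p).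
Proof. by move=> a b /(congr1 (@^~ (exist _ (nerve0 p) (le_source_nerve0 p)))). Qed.

Lemma godement_exact0 p x :
  godement_trans 0 p x = 0 <-> exists a, godement_aug p a = x.
Proof.
split=> [dx|[a <-]]; last first.
  apply: functional_extensionality_dep => -[c pc].
  rewrite [LHS]godement_diffE big_ord_recl big_ord1 /= /godement_const.
  by rewrite expr0 expr1 mul1r mulN1r subrr.
exists (x (exist _ (nerve0 p) (le_source_nerve0 p))).
apply: functional_extensionality_dep => -[c pc].
(* The edge from [p] to the vertex [c] has [c] and [p] as its faces, so [x] takes the same value at
   both. *)
have := congr1 (@^~ (exist _ (nerve_cons pc) (le_source_cons pc))) dx.
rewrite [X in X = _ -> _]godement_diffE big_ord_recl big_ord1 /=.
rewrite expr0 expr1 mul1r mulN1r => /eqP; rewrite subr_eq0 => /eqP e.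
rewrite /= /godement_const; apply: etrans (etrans (esym e) _).
  apply: godement_irr; apply/val_inj/ffunP => i.
  rewrite /= !ffunE (_ : lift _ _ = ord0) ?unlift_none //.
  by apply: val_inj; rewrite (ord1 i).
by apply: godement_irr; apply: face_nerve_cons0.
Qed.

Lemma godement_exact n p x :
  godement_trans n.+1 p x = 0 <-> exists y, godement_trans n p y = x.
Proof.
split=> [dx|[y <-]]; last first.
  apply: functional_extensionality_dep => -[c pc] /=.
  rewrite godement_diffE; apply: etrans (congr1 (@^~ c) (nerve_diffK (godement_ext y))).
  by apply: eq_bigr.
(* The cone operator gives the primitive: in the cocycle condition on the simplex with [p] prepended
   to [c], face 0 gives [x] at [c] and the other faces give the differential of [y]. *)
pose y : godement n p := fun c => x (exist _ (nerve_cons (svalP c)) (le_source_cons (svalP c))).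
exists y; apply: functional_extensionality_dep => -[c pc] /=.
have := congr1 (@^~ (exist _ (nerve_cons pc) (le_source_cons pc))) dx.
rewrite [X in X = _ -> _]godement_diffE big_ord_recl /= expr0 mul1r.
move=> /eqP; rewrite addr_eq0 => /eqP e.
rewrite godement_diffE; symmetry; apply: etrans (etrans _ e) _.
  by apply: godement_irr; rewrite face_nerve_cons0.
rewrite -sumrN; apply: eq_bigr => k _.
rewrite exprS mulN1r mulNr opprK; congr (_ * _).
by apply: godement_irr; apply: face_nerve_consS.
Qed.

Definition nerve_lim n (b : nerve P n -> int) : dprod (godement n) :=
  fun p c => b (sval c).

Lemma nerve_lim_compatible n b : @nerve_lim n b \in @compatible _ _ (godement n).
Proof. by apply/asboolP. Qed.

Definition nerve_cochain n (b : nerve P n -> int) : cochains (godement n) 0 :=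
  lim_cochain (Lim (nerve_lim_compatible b)).

Lemma nerve_cochain_additive n : zmod_morphism (@nerve_cochain n).
Proof. by []. Qed.
HB.instance Definition _ n :=
  GRing.isZmodMorphism.Build _ _ (@nerve_cochain n) (@nerve_cochain_additive n).

Lemma nerve_cohomology n :
  zmod_iso (cohomology simplicial_cochains n) (cohomology (nerve_cochains P) n).
Proof.
have G_acyclic m : acyclic le0T (godement m) by apply: coinduced_acyclic.
apply: (@resolution_cohomology godement godement_trans godement_aug G_acyclic
  godement_aug_inj godement_exact0 godement_exact
  (nerve_cochains P) (fun m => @nerve_cochain m)).
- move=> m b b' e; apply/funext => c.
  have [v [vc _]] := last_vertex_ex P_simplex_like le0T (nerve_source c).
  by have := congr1 (fun f : cochains (godement m) 0 => f v (exist _ c vc)) e.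
- move=> m x; split=> [|[b <-]]; last exact: cochain_diff_lim.
  have [/(_ x) h _] := G_acyclic m => /h [z <-].
  (* The cochain is recovered at [c] from the member of the family at the source of [c], the largest
     [p] for which [c] occurs in [godement m p]. *)
  exists (fun c => val z (nerve_source c) (exist _ c (lexx _))).
  apply: functional_extensionality_dep => q.
  apply: functional_extensionality_dep => -[c qc].
  have /asboolP/(_ _ _ qc) e := valP z.
  apply: etrans (esym (congr1 (@^~ (exist _ c (lexx _))) e)) _.
  exact: (godement_irr (p := val q)).
- move=> m b; apply: functional_extensionality_dep => q.
  apply: functional_extensionality_dep => -[c qc].
  exact: godement_diffE.
Qed.

End Comparison.

Theorem proposition6p8 (disp : Order.disp_t) (P : porderType disp)
    (P_simplex_like : simplex_like P)
    (le0 : rel (Ob P 0)) (le0_total : total_order le0) :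
  exists (d : forall n, {additive (Ob P n -> int) -> (Ob P n.+1 -> int)})
         (dK : forall n (x : Ob P n -> int), d n.+1 (d n x) = 0),
    let C := @CochainComplex (fun n => Ob P n -> int) d dK in
    [/\ forall n (p : Ob P n.+1) (x : Ob P n -> int),
          d n x p =
            \sum_(j < n.+2) (-1) ^+ (n.+1 - j) * x (face le0_total p j),
        forall n, zmod_iso (cohomology C n) (cohomology (nerve_cochains P) n)
      & forall (R : injective_resolution (constZ P)) n,
          zmod_iso (cohomology C n) (cohomology (lim_complex R) n)].
Proof.
exists (fun n => @simplicial_diff _ _ _ le0_total n).
exists (@simplicial_diffK _ _ P_simplex_like _ le0_total).
split=> // [n|R n]; first exact: nerve_cohomology.
exact: lim_complex_cohomology.
Qed.
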